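(* Let $K$ be a knowledge base in $\mathcal{ALC}^\Omega$ and let $K^T$ be its translation in $\mathcal{ALCOI}$. If $K^T$ has a model in $\mathcal{ALCOI}$, then it has a finite model.
   Context: **$\mathcal{ALC}^\Omega$ syntax.** Let $N_C,N_R,N_I$ be disjoint sets of concept, role and individual names. Concepts: $A\in N_C$, $\top$, $\bot$, and, for concepts $C,D$ and $R\in N_R$: $C\sqcap D$, $C\sqcup D$, $\neg C$, $C\backslash D$, $\mathtt{Pow}(C)$, $\forall R.C$, $\exists R.C$. A knowledge base (KB) is $K=(\mathcal T,\mathcal A)$, with $\mathcal T$ (TBox) a (finite) set of inclusions $C\sqsubseteq D$, and $\mathcal A$ (ABox) a (finite) set of assertions $C(a)$, $R(a,b)$ ($a,b\in N_I$), concept membership axioms $C\in D$ and role membership axioms $(C,D)\in R$. **$\mathcal{ALCOI}$.** The standard description logic $\mathcal{ALC}$ extended with inverse roles $R^-$ (where $(x,y)\in(R^-)^I$ iff $(y,x)\in R^I$) and nominals $\{a\}$ (where $(\{a\})^I=\{a^I\}$). An interpretation $I=\langle\Delta,\cdot^I\rangle$ has a non-empty domain $\Delta$, $A^I\subseteq\Delta$, $R^I\subseteq\Delta\times\Delta$, $a^I\in\Delta$, with the usual semantics of $\top,\bot,\neg,\sqcap,\sqcup,\forall R.C,\exists R.C$. It satisfies $C\sqsubseteq D$ iff $C^I\subseteq D^I$; $C(a)$ iff $a^I\in C^I$; $R(a,b)$ iff $(a^I,b^I)\in R^I$; $C\equiv D$ abbreviates $C\sqsubseteq D$ and $D\sqsubseteq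 C$. It is a model of a KB if it satisfies all its axioms; it is finite if $\Delta$ is finite. **Translation.** Let $e$ be a new role name. For an $\mathcal{ALC}^\Omega$ concept $C$, $C^T$ is obtained by recursively replacing each subconcept $\mathtt{Pow}(D)$ by $\forall e.D^T$; $T$ commutes with all other constructors (with $C\backslash D$ read as $C\sqcap\neg D$), and $B^T=B$ for concept names $B$. For each concept $C$ occurring as an instance in a membership axiom of $K$ (i.e. $C$ in $C\in D$; $C$ and $D$ in $(C,D)\in R$) introduce a new individual name $e_C$. Then $K^T=(\mathcal T^T,\mathcal A^T)$, where $\mathcal T^T$ consists of $C^T\sqsubseteq D^T$ for each $C\sqsubseteq D\in\mathcal T$, and $C^T\equiv\exists e^-.\{e_C\}$ for each such new name $e_C$; and $\mathcal A^T$ consists of: $D^T(e_C)$ for each $C\in D$ in $\mathcal A$; $R(e_C,e_D)$ for each $(C,D)\in R$ in $\mathcal A$; $D^T(a)$ for each $D(a)$ in $\mathcal A$; $R(a,b)$ for each $R(a,b)$ in $\mathcal A$; and $(\neg\exists e.\top)(a)$ for each (original) individual name $a\in N_I$. *)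

(* Defs.v *)
From mathcomp Require Import all_boot all_classical.

Set Implicit Arguments.
Unset Strict Implicit.
Unset Printing Implicit Defensive.

Local Open Scope classical_set_scope.

(* [concept], [assertion] and [kb] are the syntax of ALC^Omega; the types
   prefixed with [o] are that of ALCOI. Concept, role and individual names form
   arbitrary types [NC], [NR] and [NI], which makes them disjoint. *)

Inductive concept (NC NR : Type) : Type :=
| CName of NC
| CTop
| CBot
| CAnd of concept NC NR & concept NC NR
| COr of concept NC NR & concept NC NR
| CNot of concept NC NR
| CDiff of concept NC NR & concept NC NR
| CPow of concept NC NR
| CAll of NR & concept NC NR
| CEx of NR & concept NC NR.

Arguments CTop {NC NR}.
Arguments CBot {NC NR}.

Inductive assertion (NC NR NI : Type) : Type :=
| AConcept of concept NC NR & NI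
| ARole of NR & NI & NI
| AMember of concept NC NR & concept NC NR        (* C \in D *)
| AMemberRole of NR & concept NC NR & concept NC NR. (* (C,D) \in R *)

Arguments AConcept {NC NR NI}.
Arguments ARole {NC NR NI}.
Arguments AMember {NC NR NI}.
Arguments AMemberRole {NC NR NI}.

(* A pair [(C, D)] in a TBox is the inclusion "C is subsumed by D". *)
Record kb (NC NR NI : Type) : Type := KB {
  tbox : set (concept NC NR * concept NC NR);
  abox : set (assertion NC NR NI);
  tbox_finite : finite_set tbox;
  abox_finite : finite_set abox }.

Inductive role (NR : Type) : Type :=
| RName of NR
| RInv of NR.

Inductive oconcept (NC NR NI : Type) : Type :=
| OName of NC
| OTop
| OBot
| OAnd of oconcept NC NR NI & oconcept NC NR NI
| OOr of oconcept NC NR NI & oconcept NC NR NI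
| ONot of oconcept NC NR NI
| OAll of role NR & oconcept NC NR NI
| OEx of role NR & oconcept NC NR NI
| ONominal of NI.

Arguments OName {NC NR NI}.
Arguments OTop {NC NR NI}.
Arguments OBot {NC NR NI}.
Arguments ONominal {NC NR NI}.

Inductive oassertion (NC NR NI : Type) : Type :=
| OAConcept of oconcept NC NR NI & NI
| OARole of role NR & NI & NI.

Arguments OAConcept {NC NR NI}.
Arguments OARole {NC NR NI}.

(* No finiteness is imposed here: the translation of a finite knowledge base
   has one assertion for every element of [NI], which may be infinite. *)
Record okb (NC NR NI : Type) : Type := OKB {
  otbox : set (oconcept NC NR NI * oconcept NC NR NI);
  oabox : set (oassertion NC NR NI) }.

Record interp (NC NR NI : Type) : Type := Interp {
  dom :> Type;
  dom_nonempty : [set: dom] !=set0;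
  iC : NC -> set dom;
  iR : NR -> set (dom * dom);
  iI : NI -> dom }.

Arguments iC {NC NR NI} i _.
Arguments iR {NC NR NI} i _.
Arguments iI {NC NR NI} i _.

Section Semantics.
Variables (NC NR NI : Type) (I : interp NC NR NI).

Definition role_sem (r : role NR) : set (I * I) :=
  match r with
  | RName R => iR I R
  | RInv R => [set p | iR I R (p.2, p.1)]
  end.

Fixpoint sem (C : oconcept NC NR NI) : set I :=
  match C with
  | OName A => iC I A
  | OTop => setT
  | OBot => set0
  | OAnd C D => sem C `&` sem D
  | OOr C D => sem C `|` sem D
  | ONot C => ~` sem C
  | OAll r C => [set x | forall y, role_sem r (x, y) -> sem C y]
  | OEx r C => [set x | exists y, role_sem r (x, y) /\ sem C y]
  | ONominal a => [set iI I a]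
  end.

Definition sat_assertion (phi : oassertion NC NR NI) : Prop :=
  match phi with
  | OAConcept C a => sem C (iI I a)
  | OARole r a b => role_sem r (iI I a, iI I b)
  end.

Definition model (K : okb NC NR NI) : Prop :=
  (forall C D, otbox K (C, D) -> sem C `<=` sem D) /\
  (forall phi, oabox K phi -> sat_assertion phi).

Definition finite_interp : Prop := finite_set [set: I].

End Semantics.

Inductive trole (NR : Type) : Type :=
| OldRole of NR
| NewE.

Arguments NewE {NR}.

(* [EInd C] is the new individual name e_C. It is available for every concept
   [C], but [trans] has axioms about it only when [C] is an instance in a
   membership axiom; the interpretation of the other ones is irrelevant. *)
Inductive tind (NC NR NI : Type) : Type :=
| OldInd of NI
| EInd of concept NC NR.

Arguments OldInd {NC NR NI}.
Arguments EInd {NC NR NI}.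

Section Translation.
Variables NC NR NI : Type.

Notation tconcept := (oconcept NC (trole NR) (tind NC NR NI)).
Notation tassertion := (oassertion NC (trole NR) (tind NC NR NI)).

Fixpoint tr (C : concept NC NR) : tconcept :=
  match C with
  | CName A => OName A
  | CTop => OTop
  | CBot => OBot
  | CAnd C D => OAnd (tr C) (tr D)
  | COr C D => OOr (tr C) (tr D)
  | CNot C => ONot (tr C)
  | CDiff C D => OAnd (tr C) (ONot (tr D))
  | CPow C => OAll (RName NewE) (tr C)
  | CAll R C => OAll (RName (OldRole R)) (tr C)
  | CEx R C => OEx (RName (OldRole R)) (tr C)
  end.

Definition instance_in (K : kb NC NR NI) (C : concept NC NR) : Prop :=
  (exists D, abox K (AMember C D)) \/
  (exists R D, abox K (AMemberRole R C D) \/ abox K (AMemberRole R D C)).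

Inductive trans_tbox (K : kb NC NR NI) : set (tconcept * tconcept) :=
| TT_incl C D of tbox K (C, D) :
    trans_tbox K (tr C, tr D)
| TT_ext_l C of instance_in K C :
    trans_tbox K (tr C, OEx (RInv NewE) (ONominal (EInd C)))
| TT_ext_r C of instance_in K C :
    trans_tbox K (OEx (RInv NewE) (ONominal (EInd C)), tr C).

Inductive trans_abox (K : kb NC NR NI) : set tassertion :=
| TA_member C D of abox K (AMember C D) :
    trans_abox K (OAConcept (tr D) (EInd C))
| TA_member_role R C D of abox K (AMemberRole R C D) :
    trans_abox K (OARole (RName (OldRole R)) (EInd C) (EInd D))
| TA_concept D a of abox K (AConcept D a) :
    trans_abox K (OAConcept (tr D) (OldInd a))
| TA_role R a b of abox K (ARole R a b) :
    trans_abox K (OARole (RName (OldRole R)) (OldInd a) (OldInd b))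
| TA_no_elements a :
    trans_abox K (OAConcept (ONot (OEx (RName NewE) OTop)) (OldInd a)).

Definition trans (K : kb NC NR NI) : okb NC (trole NR) (tind NC NR NI) :=
  OKB (trans_tbox K) (trans_abox K).

End Translation.

(* Main.v *)
(* Filtration: identify the elements of a model that satisfy the same concepts
   of a finite subconcept-closed set, and take as roles the images of the roles
   of the model, which treats a role and its inverse alike.  A nominal in the
   set forces the class of its individual to be a singleton, so nominals survive
   the quotient.  The concepts occurring in the translation form a finite set
   even when there are infinitely many individual names, since all the axioms
   added for these names share the single concept [ONot (OEx e OTop)]. *)
Require Import Defs.
From mathcomp Require Import all_boot all_classical.

Set Implicit Arguments.
Unset Strict Implicit.
Unset Printing Implicit Defensive.

Local Open Scope classical_set_scope.

Lemma finite_set_powerset T (A : set T) :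
  finite_set A -> finite_set [set B | B `<=` A].
Proof.
(* [{classic T}] equips the bare type [T] with the classical equality that listing its elements
   requires. A subset of [x :: s] is a subset of [s], or such a subset with [x] added. *)
move=> /(@finite_seqP {classic T})[s ->]; elim: s => [|x s IHs].
  apply: (@sub_finite_set _ _ [set set0]) => // B /= B0.
  by apply/seteqP; split=> // y /B0; rewrite /= in_nil.
apply: (@sub_finite_set _ _ ([set B | B `<=` [set` s]] `|`
    (fun B => x |` B) @` [set B | B `<=` [set` s]])); last first.
  by rewrite finite_setU; split=> //; exact: finite_image.
move=> B Bxs; have [Bx|nBx] := pselect (B x).
  right; exists (B `\ x); last by rewrite setDUK // => _ ->.
  by move=> y [/Bxs]; rewrite /= in_cons => /orP[/eqP|].
left=> y By; have := Bxs _ By; rewrite /= in_cons => /orP[/eqP yx|//].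
by case: nBx; rewrite -yx.
Qed.

Section Subconcepts.
Variables NC NR NI : Type.
Implicit Types C D : oconcept NC NR NI.

Fixpoint subconcept C : set (oconcept NC NR NI) :=
  [set C] `|` match C with
  | OName _ | OTop | OBot | ONominal _ => set0
  | OAnd D E | OOr D E => subconcept D `|` subconcept E
  | ONot D | OAll _ D | OEx _ D => subconcept D
  end.

Lemma subconcept_refl C : subconcept C C.
Proof. by case: C => *; left. Qed.

Lemma subconcept_trans C D : subconcept C D -> subconcept D `<=` subconcept C.
Proof.
elim: C => [A||| C IHC E IHE | C IHC E IHE | C IHC | r C IHC | r C IHC | a];
  move=> [-> // | //=].
- by case=> [/IHC s|/IHE s] F /s ?; right; [left|right].
- by case=> [/IHC s|/IHE s] F /s ?; right; [left|right].
- by move=> /IHC s F /s ?; right.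
- by move=> /IHC s F /s ?; right.
- by move=> /IHC s F /s ?; right.
Qed.

Lemma finite_subconcept C : finite_set (subconcept C).
Proof.
by elim: C => *; rewrite /= finite_setU; split=> //; rewrite finite_setU.
Qed.

End Subconcepts.

Section Filtration.
Variables (NC NR NI : Type) (I : interp NC NR NI).
Variable S : set (oconcept NC NR NI).

Definition ctype (x : I) : set (oconcept NC NR NI) :=
  [set C | S C /\ sem C x].

(** The quotient is encoded as the set of realized types, so a class is literally a subset of [S]
    and finiteness reduces to that of a powerset. *)
Definition class (x : I) : set_type (range ctype) :=
  SigSub (mem_set (imageT ctype x)).

Lemma class_surj (t : set_type (range ctype)) : exists x, class x = t.
Proof. by have [x _ xt] := set_mem (valP t); exists x; exact: val_inj. Qed.

Lemma class_sem x y C : class x = class y -> S C -> sem C x -> sem C y.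
Proof.
move=> /(congr1 val) /= xy SC Cx.
by have [] : ctype y C by rewrite -xy.
Qed.

Lemma class_nonempty : [set: set_type (range ctype)] !=set0.
Proof. by have [x _] := dom_nonempty I; exists (class x). Qed.

Definition filtration : interp NC NR NI :=
  @Interp NC NR NI (set_type (range ctype)) class_nonempty
    (fun A => class @` iC I A)
    (fun R => [set p | exists x y,
      [/\ class x = p.1, class y = p.2 & iR I R (x, y)]])
    (fun a => class (iI I a)).

(** Taking images commutes with inversion: for [RInv] the same two representatives serve in swapped
    order. Quantifiers over both kinds of role can then be treated at once. *)
Lemma role_sem_filtration r s t : role_sem (I := filtration) r (s, t) <->
  exists x y, [/\ class x = s, class y = t & role_sem r (x, y)].
Proof.
by case: r => R //=; split=> -[x [y [xs yt xy]]]; exists y, x.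
Qed.

Hypothesis Ssub : forall C, S C -> subconcept C `<=` S.

(** The truth lemma of filtration, by induction on [C]. Closure of [S] under subconcepts gives
    access to the induction hypotheses, and [class_sem] moves concepts of [S] between
    representatives. *)
Lemma sem_filtration C x : S C -> sem (I := filtration) C (class x) <-> sem C x.
Proof.
elim: C x => [A||| C IHC D IHD | C IHC D IHD | C IHC | r C IHC | r C IHC | a] x
  SC //=.
- split=> [[y Ay yx]|Ax]; last by exists x.
  exact: (class_sem yx SC Ay).
- have SC1 : S C by apply: (Ssub SC); right; left; exact: subconcept_refl.
  have SD1 : S D by apply: (Ssub SC); right; right; exact: subconcept_refl.
  by rewrite /setI /= IHC // IHD.
- have SC1 : S C by apply: (Ssub SC); right; left; exact: subconcept_refl.
  have SD1 : S D by apply: (Ssub SC); right; right; exact: subconcept_refl.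
  by rewrite /setU /= IHC // IHD.
- have SC1 : S C by apply: (Ssub SC); right; exact: subconcept_refl.
  by rewrite /setC /= IHC.
- have SC1 : S C by apply: (Ssub SC); right; exact: subconcept_refl.
  split=> [H y xy|H t /role_sem_filtration[x' [y [x'x <- x'y]]]].
    by apply/IHC => //; apply: H; apply/role_sem_filtration; exists x, y.
  (* The edge starts at a representative [x'] that may differ from [x]. The whole concept [OAll r C]
     lies in [S], so it passes from [x] to [x']. *)
  have /= Hx' := class_sem (esym x'x) SC H.
  by apply/IHC => //; exact: Hx' x'y.
- have SC1 : S C by apply: (Ssub SC); right; exact: subconcept_refl.
  split=> [[t [/role_sem_filtration[x' [y [x'x <- x'y]]] /IHC Cy]]|].
    (* Conversely, the existential is witnessed at [x'] and passed back to [x]. *)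
    by apply: (class_sem x'x SC); exists y; split=> //; exact: Cy.
  move=> [y [xy Cy]]; exists (class y); split; last exact/IHC.
  by apply/role_sem_filtration; exists x, y.
(* The element named [a] satisfies its own nominal, so every [x] in its class does too and equals
   it. *)
- by split=> [/esym xa|-> //]; exact: (class_sem xa SC).
Qed.

Lemma finite_filtration : finite_set S -> finite_interp filtration.
Proof.
move=> Sfin; rewrite /finite_interp.
have rfin : finite_set (range ctype).
  apply: (@sub_finite_set _ _ [set T | T `<=` S]); last exact: finite_set_powerset.
  by move=> _ [x _ <-] C [].
have -> : [set: filtration] = val @^-1` range ctype.
  by apply/seteqP; split=> t // _; exact: set_mem (valP t).
by apply: finite_preimage => // s t _ _; exact: val_inj.
Qed.

(** Concept axioms transfer by the truth lemma at a representative; role assertions transfer because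
    roles are images. *)
Lemma model_filtration (K : okb NC NR NI) :
  (forall C D, otbox K (C, D) -> S C /\ S D) ->
  (forall C a, oabox K (OAConcept C a) -> S C) ->
  model I K -> model filtration K.
Proof.
move=> St Sa [It Ia]; split.
  move=> C D CD t; have [x <-] := class_surj t; have [SC SD] := St _ _ CD.
  by move=> /(sem_filtration _ SC) /(It _ _ CD) /(sem_filtration _ SD).
move=> [C a|r a b] phiK; have := Ia _ phiK.
  by move=> Ca; apply/sem_filtration => //; exact: Sa phiK.
by move=> /= ab; apply/role_sem_filtration; exists (iI I a), (iI I b).
Qed.

End Filtration.

Lemma finite_model_property (NC NR NI : Type) (K : okb NC NR NI)
    (S : set (oconcept NC NR NI)) (I : interp NC NR NI) :
  finite_set S ->
  (forall C D, otbox K (C, D) -> S C /\ S D) ->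
  (forall C a, oabox K (OAConcept C a) -> S C) ->
  model I K -> exists J : interp NC NR NI, finite_interp J /\ model J K.
Proof.
move=> Sfin St Sa IK.
(* Closing [S] under subconcepts keeps it finite, as a finite union of finite sets. *)
pose S' := \bigcup_(C in S) subconcept C.
have SS' C : S C -> S' C by move=> SC; exists C => //; exact: subconcept_refl.
exists (filtration I S'); split.
  apply: finite_filtration; apply: bigcup_finite => // C _.
  exact: finite_subconcept.
apply: model_filtration IK.
- move=> C [D SD CD] E EC; exists D => //; exact: subconcept_trans EC.
- by move=> C D /St [/SS' ? /SS' ?].
- by move=> C a /Sa /SS'.
Qed.

Section TranslationConcepts.
Variables (NC NR NI : Type) (K : kb NC NR NI).

Definition assertion_concepts (phi : assertion NC NR NI) :
    set (concept NC NR) :=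
  match phi with
  | AConcept C _ => [set C]
  | ARole _ _ _ => set0
  | AMember C D | AMemberRole _ C D => [set C; D]
  end.

Definition kb_concepts : set (concept NC NR) :=
  fst @` tbox K `|` snd @` tbox K `|`
  \bigcup_(phi in abox K) assertion_concepts phi.

Lemma finite_kb_concepts : finite_set kb_concepts.
Proof.
rewrite !finite_setU; split.
  by split; apply: finite_image; exact: tbox_finite.
apply: bigcup_finite; first exact: abox_finite.
by case=> * /=; rewrite ?finite_setU //; split.
Qed.

Lemma instance_kb_concepts C : instance_in K C -> kb_concepts C.
Proof.
move=> [[D CD]|[R [D [CD|DC]]]]; right.
- by exists (AMember C D) => //; left.
- by exists (AMemberRole R C D) => //; left.
- by exists (AMemberRole R D C) => //; right.
Qed.

(** A finite superset of the concepts at the top level of the axioms: the [e_C] part ranges over all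
    of [kb_concepts], which contains every membership instance. *)
Definition trans_concepts : set (oconcept NC (trole NR) (tind NC NR NI)) :=
  @tr NC NR NI @` kb_concepts `|`
  (fun C => OEx (RInv NewE) (ONominal (EInd C))) @` kb_concepts `|`
  [set ONot (OEx (RName NewE) OTop)].

Lemma finite_trans_concepts : finite_set trans_concepts.
Proof.
have fin := finite_kb_concepts.
by rewrite !finite_setU; split=> //; split; exact: finite_image.
Qed.

Lemma trans_tbox_concepts C D :
  otbox (trans K) (C, D) -> trans_concepts C /\ trans_concepts D.
Proof.
move=> CD; inversion CD as [C' D' CD'|C' inst|C' inst].
- split; left; left.
  + by exists C' => //; left; left; exists (C', D').
  + by exists D' => //; left; right; exists (C', D').
- by move/instance_kb_concepts: inst => ?; split; left; [left|right]; exists C'.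
- by move/instance_kb_concepts: inst => ?; split; left; [right|left]; exists C'.
Qed.

Lemma trans_abox_concepts C a :
  oabox (trans K) (OAConcept C a) -> trans_concepts C.
Proof.
move=> Ca; inversion Ca as [E D ED| |D b Db| |b].
- by left; left; exists D => //; right; exists (AMember E D) => //; right.
- by left; left; exists D => //; right; exists (AConcept D b).
- by right.
Qed.

End TranslationConcepts.

Theorem proposition2 (NC NR NI : Type) (K : kb NC NR NI) :
  (exists I : interp NC (trole NR) (tind NC NR NI), model I (trans K)) ->
  exists I : interp NC (trole NR) (tind NC NR NI),
    finite_interp I /\ model I (trans K).
Proof.
move=> [I]; apply: (finite_model_property (finite_trans_concepts K)).
- exact: trans_tbox_concepts.
- exact: trans_abox_concepts.
Qed.
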